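(* Let $\Bbbk$ be a field of characteristic $0$ and let $t,m,n$ be integers with $m\le n$, $1<t<m$ and $n>t+1$. Let $A_t$ be the algebra of $t$-minors of an $m\times n$ matrix of indeterminates over $\Bbbk$. The ring of invariants $A_t^U$ is generated as a $\Bbbk$-algebra by the products of initial minors $[c_\lambda|c_\lambda]$, where $\lambda$ is an admissible partition with at most $m-1$ parts. Furthermore, it is generated up to degree $m$.
   Context: Let $X=(x_{ij})$ be an $m\times n$ matrix of indeterminates, $R=\Bbbk[x_{ij}]$, $A_t\subseteq R$ the $\Bbbk$-subalgebra generated by the $t$-minors of $X$, graded so that $t$-minors have degree $1$ (elements of $R$-degree $td$ have degree $d$). Let $W,V$ be $\Bbbk$-vector spaces of dimension $m,n$ with fixed bases; $G=\operatorname{GL}(W)\times\operatorname{GL}(V)$ acts on $R$ by $\Bbbk$-algebra automorphisms, where $(A,B)$ sends $x_{ij}$ to the $(i,j)$ entry of $A\cdot X\cdot B^{-1}$, and $A_t$ is stable under $G$. Let $U=U_-(W)\times U_+(V)\subseteq G$, with $U_-(W)$ the lower triangular matrices of $\operatorname{GL}(W)$ with $1$'s on the diagonal and $U_+(V)$ the upper triangular matrices of $\operatorname{GL}(V)$ with $1$'s on the diagonal. For a partition $\lambda=(\lambda_1\ge\dots\ge\lambda_k\ge1)$ with $\lambda_1\le m$, $[c_\lambda|c_\lambda]=\prod_{i=1}^k[1,\ldots,\lambda_i|1,\ldots,\lambda_i]$, where $[1,\dots,s|1,\dots,s]$ is the minor of $X$ on the first $s$ rows and the first $s$ columns. The partition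 $\lambda$ with $k$ parts is admissible if $t$ divides $|\lambda|=\lambda_1+\dots+\lambda_k$ and $tk\le|\lambda|$. *)

(* Defs.v *)
From mathcomp Require Import all_boot all_order all_algebra.
From mathcomp Require Export mpoly.

Set Implicit Arguments.
Unset Strict Implicit.
Unset Printing Implicit Defensive.

Import GRing.Theory.
Local Open Scope ring_scope.

Inductive subalg_gen (K : fieldType) (A : algType K) (S : A -> Prop) :
    A -> Prop :=
| subalg_gen_in x : S x -> subalg_gen S x
| subalg_gen_scalar (c : K) : subalg_gen S c%:A
| subalg_gen_add x y : subalg_gen S x -> subalg_gen S y -> subalg_gen S (x + y)
| subalg_gen_mul x y : subalg_gen S x -> subalg_gen S y -> subalg_gen S (x * y).

(* [B] is the set of elements of a subalgebra, [S] a generating set of it;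
   in particular [S] is contained in [B]. *)
Definition generates (K : fieldType) (A : algType K) (S B : A -> Prop) : Prop :=
  forall x, B x <-> subalg_gen S x.

Section MinorAlgebra.

Variables (K : fieldType) (m n : nat).

(* The polynomial ring in the m * n variables x_ij; [mxvec_index] is the
   bijection from pairs (i, j) to variable numbers. *)
Local Notation R := {mpoly K[m * n]}.

Definition genmx : 'M[R]_(m, n) := \matrix_(i, j) 'X_(mxvec_index i j).

Definition is_minor (t : nat) (p : R) : Prop :=
  exists (f : 'I_t -> 'I_m) (g : 'I_t -> 'I_n),
    [/\ {homo f : a b / (a < b)%N}, {homo g : a b / (a < b)%N}
      & p = \det (mxsub f g genmx)].

Definition minor_algebra (t : nat) : R -> Prop := subalg_gen (@is_minor t).

Definition minor_algebra_deg (t d : nat) (p : R) : Prop :=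
  minor_algebra t p /\ p \is (t * d)%N.-homog.

(* The K-algebra endomorphism of R sending x_ij to the (i, j) entry of
   A *m X *m B^-1; only meaningful for invertible A and B. *)
Definition gl_act (A : 'M[K]_m) (B : 'M[K]_n) (p : R) : R :=
  p \mPo [tuple mxvec (map_mx (@mpolyC (m * n) K) A *m genmx
                         *m map_mx (@mpolyC (m * n) K) (invmx B)) 0 k
         | k < m * n].

(* [is_trig_mx] means lower triangular.  Matrices satisfying these predicates
   have determinant 1 ([det_trig]), hence lie in the general linear group. *)
Definition lower_unitriangular (r : nat) (A : 'M[K]_r) : Prop :=
  is_trig_mx A /\ forall i, A i i = 1.

Definition upper_unitriangular (r : nat) (B : 'M[K]_r) : Prop :=
  lower_unitriangular B^T.

Definition U_invariant (p : R) : Prop :=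
  forall (A : 'M[K]_m) (B : 'M[K]_n),
    lower_unitriangular A -> upper_unitriangular B -> gl_act A B p = p.

Definition minor_invariants (t : nat) (p : R) : Prop :=
  minor_algebra t p /\ U_invariant p.

(* Partitions with parts at most m are sequences over 'I_m.+1 = {0, ..., m};
   [initial_minor hmn s] is [1, ..., s | 1, ..., s]. *)
Definition initial_minor (hmn : (m <= n)%N) (s : 'I_m.+1) : R :=
  \det (mxsub (widen_ord (leq_ord s)) (widen_ord (leq_trans (leq_ord s) hmn))
          genmx).

Definition initial_minor_prod (hmn : (m <= n)%N) (lam : seq 'I_m.+1) : R :=
  \prod_(s <- lam) initial_minor hmn s.

End MinorAlgebra.

Definition is_partition (m : nat) (lam : seq 'I_m.+1) : bool :=
  sorted geq (map val lam) && all (fun s : 'I_m.+1 => (0 < s)%N) lam.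

Definition admissible (t m : nat) (lam : seq 'I_m.+1) : bool :=
  let weight := (\sum_(s <- lam) s)%N in
  (t %| weight)%N && (t * size lam <= weight)%N.

Arguments genmx K m n : clear implicits.

(* Main.v *)
Require Import Defs.
From mathcomp Require Import all_boot all_order all_algebra all_fingroup.
From mathcomp Require Import zify ring.

(** Write delta_s for the initial s-minor, A_t for the algebra of t-minors, and
    U for the unipotent group acting on the matrix X of indeterminates.  The
    heart of the matter is that the products of initial minors of admissible
    shape form a basis of A_t^U; the bounds on the generators then come from
    decomposing admissible shapes.  There are four independent ingredients.

    Admissible products lie in A_t ([generic_minor_prod_algebra]).  An
    admissible shape of weight t * d, completed to d parts by parts 0, has
    average part t, so it suffices to replace a product of a u-minor and a
    v-minor, u < t < v, by products of (u+1)-minors and (v-1)-minors until all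
    the parts are t ([minor_product_balance]).  Each such replacement is a linear
    identity whose coefficients have denominators with factors at most v, which
    is where characteristic 0 enters ([det_mask_straighten]).

    Every U-invariant p is a polynomial in the delta_s
    ([invariant_initial_minors]).  The map X |-> (delta_1, ..., delta_m) has a
    polynomial section y |-> S(y) ([section_mx]), and a matrix over the field
    whose initial minors are all nonzero is U-equivalent to a diagonal matrix
    determined by these minors, hence U-equivalent to S(delta(X)).  So
    p(X) = p(S(delta(X))) on a Zariski dense set, thus everywhere.

    Only admissible shapes occur in an invariant of A_t
    ([initial_minors_in_algebra_support]).  On diagonal matrices the products
    of the delta_s become pairwise distinct monomials, while t-minors become 0
    or squarefree monomials of degree t; so the monomials coming from A_t have
    a degree t * d and exponents at most d.  The exponent of the first
    diagonal entry is the number of parts of the shape.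

    Finally, a shape of d parts with values in [0, m] and average t is a
    sequence of deviations in [- t, m - t] with sum zero.  Ordered so that its
    partial sums stay in a window of m values, such a sequence has a proper
    zero-sum block as soon as d > m ([zero_sum_splits]); and if no part is 0
    the window has only m - 1 values.  Hence the indecomposable shapes have
    degree d <= m and at most m - 1 nonzero parts
    ([initial_minor_prod_small]). *)

Set Implicit Arguments.
Unset Strict Implicit.
Unset Printing Implicit Defensive.

Import Order.TTheory GRing.Theory Num.Theory.
Local Open Scope ring_scope.

(** * Splitting zero-sum sequences *)

(** Greedy choice: while the running sum is positive append a negative term,
    otherwise a nonnegative one.  A suitable term is always left, because the
    running sum and the remaining terms add up to zero. *)
Lemma balanced_reordering (T : eqType) (f : T -> int) (a b : nat) (s : seq T)
    (c : int) :
    (0 < a)%N -> (0 < b)%N -> all (fun x => - a%:Z <= f x <= b%:Z) s ->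
    - a%:Z < c <= b%:Z -> c + \sum_(x <- s) f x = 0 ->
  exists s', perm_eq s s' /\
    forall i, - a%:Z < c + \sum_(x <- take i s') f x <= b%:Z.
Proof.
move=> a0 b0; move: {2}(size s) (erefl (size s)) => k.
elim: k s c => [|k IHk] s c.
  move/size0nil=> -> _ c_bd _; exists [::]; split=> // i.
  by rewrite big_nil addr0.
move=> sz_s s_bd c_bd sum0.
have [x xs fx]: exists2 x, x \in s & - a%:Z < c + f x <= b%:Z.
  have [c_gt0|c_le0] := ltP 0 c.
    have /hasP[x xs fx]: has (fun x => f x < 0) s.
      apply/negPn; rewrite -all_predC; apply/negP=> /allP s_ge0.
      suff: 0 <= \sum_(x <- s) f x by lia.
      rewrite big_seq sumr_ge0 // => x /s_ge0 /=; lia.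
    exists x => //; move/allP/(_ x xs): s_bd; lia.
  have /hasP[x xs fx]: has (fun x => 0 <= f x) s.
    apply/negPn; rewrite -all_predC; apply/negP=> /allP s_lt0.
    case: s sz_s s_lt0 sum0 {s_bd} => // y s _ s_lt0; rewrite big_cons.
    have := s_lt0 y (mem_head _ _); rewrite /= -ltNge => fy sum0.
    have: \sum_(x <- s) f x <= 0.
      rewrite big_seq sumr_le0 // => x xs.
      by have:= s_lt0 x; rewrite inE xs orbT /= => /(_ isT); lia.
    by move: (\sum_(x <- s) f x) sum0 => r; lia.
  exists x => //; move/allP/(_ x xs): s_bd; lia.
have s_perm := perm_to_rem xs.
have [|||s' [s's s'_bd]] := IHk (rem x s) (c + f x) _ _ fx.
- by rewrite size_rem ?sz_s.
- by apply/allP=> y /mem_rem; apply: (allP s_bd).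
- by rewrite -addrA; move: sum0; rewrite (perm_big _ s_perm) big_cons.
exists (x :: s'); split.
  by rewrite (perm_trans s_perm) // perm_cons.
by case=> [|i] /=; rewrite ?big_nil ?addr0 // big_cons addrA.
Qed.

(** After a balanced reordering all partial sums lie among the a + b integers
    of ]- a, b], so two of the first a + b + 1 nonempty prefixes have equal
    sums, and the terms between their ends form a proper zero-sum block. *)
Lemma zero_sum_splits (T : eqType) (f : T -> int) (a b : nat) (s : seq T) :
    (0 < a)%N -> (0 < b)%N -> all (fun x => - a%:Z <= f x <= b%:Z) s ->
    \sum_(x <- s) f x = 0 -> (a + b < size s)%N ->
  exists s1 s2,
    [/\ perm_eq s (s1 ++ s2), s1 != [::], s2 != [::],
        \sum_(x <- s1) f x = 0 & \sum_(x <- s2) f x = 0].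
Proof.
move=> a0 b0 s_bd sum0 sz_s.
have [||s' [s_perm s'_bd]] := balanced_reordering (c := 0) a0 b0 s_bd; [lia| |].
  by rewrite add0r.
pose S i : int := \sum_(x <- take i s') f x.
pose window : seq int := [seq k%:Z - a%:Z + 1 | k <- iota 0 (a + b)].
have: ~~ uniq [seq S i | i <- iota 1 (size s)].
  apply/negP=> uniqS; have := @uniq_leq_size _ _ window uniqS.
  rewrite !size_map !size_iota leqNgt sz_s => in_window.
  suff /in_window: {subset [seq S i | i <- iota 1 (size s)] <= window} by [].
  move=> _ /mapP[i _ ->].
  have := s'_bd i; rewrite add0r -/(S i) => S_bd.
  apply/mapP; exists (absz (S i + a%:Z - 1)%R); last by lia.
  by rewrite mem_iota; lia.
case/(uniqPn 0)=> i [j] []; rewrite size_map size_iota => lt_ij lt_j.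
rewrite !(nth_map 0%N) ?size_iota ?(ltn_trans lt_ij) //.
rewrite !nth_iota ?(ltn_trans lt_ij) // !add1n => Sij.
have sz' : size s' = size s by rewrite -(perm_size s_perm).
pose s1 := drop i.+1 (take j.+1 s').
pose s2 := take i.+1 s' ++ drop j.+1 s'.
have take_i : take i.+1 s' = take i.+1 (take j.+1 s') 
  by rewrite take_takel // ltnW.
have s'E : perm_eq s' (s1 ++ s2).
  rewrite /s1 /s2 take_i catA perm_sym.
  rewrite -[X in perm_eq _ X](cat_take_drop j.+1) perm_cat2r.
  by rewrite perm_catC cat_take_drop.
have sum1 : \sum_(x <- s1) f x = 0.
  move: Sij; rewrite /S take_i -[in RHS](cat_take_drop i.+1 (take j.+1 s')).
  by rewrite big_cat /= -[LHS]addr0 => /addrI/esym.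
exists s1, s2; split=> //.
- exact: perm_trans s'E.
- by rewrite -size_eq0 size_drop size_takel ?sz' //; lia.
- by rewrite -size_eq0 size_cat size_takel ?sz' //; lia.
move: sum0; rewrite (perm_big _ s_perm) (perm_big _ s'E) big_cat /= sum1.
by rewrite add0r.
Qed.

(** * Straightening a product of two minors *)

(** When S and T have u elements, this is a block matrix up to permutations of
    rows and columns, so its determinant is, up to sign, the product of the
    minors of M on (S, T) and on the complements: the term of index (S, T) in
    the Laplace expansion of M. *)
Definition mask_mx (R : nzRingType) (N : nat) (S T : {set 'I_N}) (M : 'M[R]_N) :
    'M[R]_N :=
  \matrix_(i, j) (if (i \in S) == (j \in T) then M i j else 0).

(** In the expansion over permutations only those mapping S onto T survive;
    this turns linear relations between products of complementary minors into
    relations between indicators of the events s @: S == T. *)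
Lemma det_mask_mx (R : comNzRingType) (N : nat) (S T : {set 'I_N})
    (M : 'M[R]_N) :
  \det (mask_mx S T M) =
    \sum_(s : 'S_N | s @: S == T) (-1) ^+ s * \prod_i M i (s i).
Proof.
rewrite [RHS]big_mkcond; apply: eq_bigr => s _ /=.
have [sST|nsST] := eqVneq.
  congr (_ * _); apply: eq_bigr => i _.
  by rewrite mxE -sST mem_imset ?eqxx //; apply: perm_inj.
have [i Si]: exists i, (i \in S) != (s i \in T).
  apply/existsP; rewrite -negb_forall; apply: contra nsST => /forallP sST.
  apply/eqP/setP=> j; rewrite -(permKV s j) mem_imset; last exact: perm_inj.
  exact/eqP.
by rewrite (bigD1 i) //= mxE (negPf Si) mul0r mulr0.
Qed.

(** The solution of the recursion in [straightening_coef_sum]: for u < v, this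
    is the preimage of a u-subset T under the inclusion matrix from
    (u+1)-subsets to u-subsets of a set of u + v elements, evaluated at the
    subsets missing k elements of T. *)
Definition straightening_coef (K : fieldType) (v k : nat) : K :=
  (-1) ^+ k * k`!%:R / (v ^_ k.+1)%:R.

Lemma straightening_coef_sum (K : fieldType) (v k : nat) :
    [pchar K] =i pred0 -> (k < v)%N ->
  k%:R * straightening_coef K v k.-1 + (v - k)%:R * straightening_coef K v k
    = (k == 0)%:R.
Proof.
move=> /pcharf0P K0 lt_kv; rewrite /straightening_coef.
case: k lt_kv => [|k] lt_kv.
  have v0: v%:R != 0 :> K by rewrite K0 -lt0n.
  rewrite subn0 ffactn1 fact0. by rewrite mul0r add0r expr0 mul1r mul1r mulfV.
have -> : k.+1.-1 = k by [].
rewrite (ffactnSr v k.+1) factS (natrM _ (v ^_ k.+1)) (natrM _ k.+1) exprS.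
have: (v ^_ k.+1)%:R != 0 :> K by rewrite K0 -lt0n ffact_gt0 ltnW.
have: (v - k.+1)%:R != 0 :> K by rewrite K0 subn_eq0 -ltnNge.
have -> : (k.+1 == 0%N) = false by [].
move: ((v ^_ k.+1)%:R) ((v - k.+1)%:R) => w u w0 u0.
rewrite mulr0n; move: ((-1) ^+ k) (k`!%:R) (k.+1%:R) => a b c.
by field; rewrite w0 u0.
Qed.

(** By [det_mask_mx], the coefficient of a permutation s on the right is the
    sum over i outside S of the coefficient of index #|T :\: s @: (i |: S)|.
    Put k = #|T :\: s @: S|: for k of these i the image s i falls in T and the
    index is k - 1, for the v - k others it is k.  The recursion defining the
    coefficients makes the sum 1 if s @: S = T, and 0 otherwise. *)
Lemma det_mask_straighten (K : fieldType) (R : comAlgType K) (N : nat)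
    (S T : {set 'I_N}) (M : 'M[R]_N) :
    [pchar K] =i pred0 -> #|S| = #|T| -> (#|S| < N - #|S|)%N ->
  \det (mask_mx S T M) =
    \sum_(i in ~: S) \sum_(T' : {set 'I_N})
      straightening_coef K (N - #|S|) #|T :\: T'| *:
        \det (mask_mx (i |: S) T' M).
Proof.
move=> K0 eqST ltSv; set v := (N - #|S|)%N.
have sum_coef (s : 'S_N) :
    \sum_(i in ~: S) straightening_coef K v #|T :\: s @: (i |: S)|
      = (s @: S == T)%:R.
  pose T0 := T :\: s @: S.
  have card_T0 : (#|T0| <= #|S|)%N by rewrite eqST subset_leq_card ?subsetDl.
  have card_sS : #|s @: S| = #|S| by rewrite card_imset //; apply: perm_inj.
  rewrite (eq_bigr (fun i => straightening_coef K v #|T0 :\ s i|)); last first.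
    by move=> i _; rewrite imsetU1 setDDl setUC.
  rewrite (reindex_inj (@perm_inj _ (s^-1)%g)) /=.
  rewrite (eq_big (mem (~: (s @: S)))
             (fun j => straightening_coef K v #|T0 :\ j|)); first last.
  - by move=> j _; rewrite permKV.
  - move=> j /=; rewrite !inE -{2}(permKV s j) mem_imset //; exact: perm_inj.
  rewrite (bigID (mem T0)) /=.
  rewrite (eq_bigl (mem T0)); last first.
    by move=> j /=; rewrite !inE; case: (_ \in s @: S); rewrite ?andbF.
  rewrite [X in X + _](eq_bigr (fun _ => straightening_coef K v #|T0|.-1));
    last by move=> j /= jT; rewrite (cardsD1 j T0) jT.
  rewrite [X in _ + X](eq_bigr (fun _ => straightening_coef K v #|T0|));
    last by move=> j /andP[_ /= jT]; rewrite (cardsD1 j T0) (negPf jT).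
  rewrite [X in _ + X](eq_bigl (mem (~: (s @: S :|: T)))); last first.
    by move=> j /=; rewrite !inE; case: (_ \in s @: S) => //=.
  rewrite !sumr_const.
  have -> : #|~: (s @: S :|: T)| = (v - #|T0|)%N.
    have := cardsC (s @: S :|: T); rewrite card_ord cardsU => cardC.
    have := subset_leq_card (subsetIr (s @: S) T).
    by move: cardC; rewrite /T0 /v cardsD setIC card_sS -eqST; lia.
  have lt_T0 : (#|T0| < v)%N by apply: leq_ltn_trans ltSv.
  rewrite -[X in X + _]mulr_natl -[X in _ + X]mulr_natl.
  rewrite (straightening_coef_sum K0 lt_T0); congr (_%:R).
  by rewrite cards_eq0 setD_eq0 eq_sym eqEcard card_sS eqST leqnn andbT.
rewrite det_mask_mx big_mkcond /=.
transitivity (\sum_(s : 'S_N) \sum_(i in ~: S)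
    straightening_coef K v #|T :\: s @: (i |: S)|
      *: ((-1) ^+ s * \prod_i M i (s i))).
  apply: eq_bigr => s _; rewrite -scaler_suml sum_coef.
  by case: eqP; rewrite ?scale1r ?scale0r.
rewrite exchange_big; apply: eq_bigr => i _ /=.
under [RHS]eq_bigr do rewrite det_mask_mx scaler_sumr.
rewrite (exchange_big_dep xpredT) //=; apply: eq_bigr => s _.
by rewrite (big_pred1 (s @: (i |: S))) // => T'; rewrite eq_sym.
Qed.

Lemma det_mxsub_inj (R : comNzRingType) (N : nat) (h k : 'I_N -> 'I_N)
    (M : 'M[R]_N) :
  injective h -> injective k ->
  exists b : bool, \det M = (-1) ^+ b * \det (mxsub h k M).
Proof.
move=> injh injk; exists (perm injh (+) perm injk).
have -> : mxsub h k M = row_perm (perm injh) (col_perm (perm injk) M).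
  by apply/matrixP=> i j; rewrite !mxE !permE.
rewrite row_permE col_permE !det_mulmx !det_perm odd_permV signr_addb.
rewrite mulrACA mulrA -signr_addb addbb mul1r mulrCA -signr_addb addbb.
by rewrite mulr1.
Qed.

Lemma set_first_enumeration (u v : nat) (S : {set 'I_(u + v)}) :
    #|S| = u ->
  exists h : 'I_(u + v) -> 'I_(u + v), [/\ injective h,
    forall i, h (lshift v i) \in S & forall i, h (rshift u i) \notin S].
Proof.
move=> cardS; pose s := enum S ++ enum (~: S).
have sz1 : size (enum S) = u by rewrite -cardE.
have sz_s : size s = (u + v)%N.
  by rewrite size_cat -!cardE cardsC card_ord.
have uniq_s : uniq s.
  rewrite cat_uniq !enum_uniq andbT /=.
  by apply/hasPn=> x; rewrite !mem_enum inE.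
exists (fun i => nth i s i); split=> [i j | i | i].
- move=> nth_ij; apply/eqP; move/eqP: nth_ij.
  by rewrite (set_nth_default j) ?sz_s // nth_uniq ?sz_s.
- by rewrite nth_cat sz1 /= ltn_ord -mem_enum mem_nth ?sz1.
have sz2 : size (enum (~: S)) = v.
  by move: sz_s; rewrite size_cat sz1 => /addnI.
rewrite nth_cat sz1 /= ltnNge leq_addr /= addKn -in_setC -mem_enum.
by rewrite mem_nth // sz2.
Qed.

Lemma det_mask_mx_prod (R : comNzRingType) (N u v : nat) (S T : {set 'I_N})
    (M : 'M[R]_N) :
    (u + v)%N = N -> #|S| = u -> #|T| = u ->
  exists (b : bool) f g f' g', \det (mask_mx S T M) =
    (-1) ^+ b *
      (\det (@mxsub _ _ _ u u f g M) * \det (@mxsub _ _ _ v v f' g' M)).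
Proof.
move=> eqN; subst N=> /set_first_enumeration[h [injh hS hNS]].
move=> /set_first_enumeration[k [injk kT kNT]].
have [b ->] := det_mxsub_inj (mask_mx S T M) injh injk.
exists b, (h \o @lshift u v), (k \o @lshift u v).
exists (h \o @rshift u v), (k \o @rshift u v).
rewrite -(submxK (mxsub h k _)) (_ : ursubmx _ = 0); last first.
  by apply/matrixP=> i j; rewrite !mxE hS (negPf (kNT _)).
rewrite det_lblock; congr (_ * (_ * _)); congr (\det _); apply/matrixP=> i j.
  by rewrite !mxE hS kT.
by rewrite !mxE (negPf (hNS _)) (negPf (kNT _)).
Qed.

Lemma scaler_signl (K : nzRingType) (R : lalgType K) (b : bool) (x : R) :
  (-1) ^+ b *: x = (-1) ^+ b * x.
Proof. by case: b; rewrite ?scaleN1r ?mulN1r ?scale1r ?mul1r. Qed.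

(** The two minors are the diagonal blocks of a masked square matrix of size
    u + v + 1, to which [det_mask_straighten] applies; the masked determinants
    that it produces are products of a (u+1)-minor and a v-minor.  The target
    is an arbitrary subspace P so that other factors can be multiplied in. *)
Lemma minor_product_balance (K : fieldType) (R : comAlgType K) (m n : nat)
    (X : 'M[R]_(m, n)) (P : R -> Prop) (u v : nat)
    (f : 'I_u -> 'I_m) (g : 'I_u -> 'I_n)
    (f' : 'I_v.+1 -> 'I_m) (g' : 'I_v.+1 -> 'I_n) :
    [pchar K] =i pred0 -> (u <= v)%N ->
    P 0 -> (forall p q, P p -> P q -> P (p + q)) ->
    (forall (c : K) p, P p -> P (c *: p)) ->
    (forall (a : 'I_u.+1 -> 'I_m) b (a' : 'I_v -> 'I_m) b',
      P (\det (mxsub a b X) * \det (mxsub a' b' X))) ->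
  P (\det (mxsub f g X) * \det (mxsub f' g' X)).
Proof.
move=> K0 le_uv P0 PD PZ Pprod.
have Psum (I : Type) (r : seq I) (Q : pred I) F :
    (forall i, Q i -> P (F i)) -> P (\sum_(i <- r | Q i) F i).
  by move=> PF; apply: (big_ind P).
pose join (k : nat) (a : 'I_u -> 'I_k) a' (i : 'I_(u + v.+1)) :=
  match split i with inl j => a j | inr j => a' j end.
pose M := mxsub (join _ f f') (join _ g g') X.
pose S := [set lshift v.+1 i | i : 'I_u].
have cardS : #|S| = u by rewrite card_imset ?card_ord //; apply: lshift_inj.
have memS i : (i \in S) = (i < u)%N.
  case: (splitP i) => j Dj; last first.
    apply/imsetP=> -[k _ ik]; have := ltn_ord k.
    by move: Dj; rewrite ik /=; lia.
  by apply/imsetP; exists j => //; apply: val_inj.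
have -> : \det (mxsub f g X) * \det (mxsub f' g' X) = \det (mask_mx S S M).
  rewrite -(submxK (mask_mx S S M)) (_ : ursubmx _ = 0); last first.
    by apply/matrixP=> i j; rewrite !mxE !memS /= ltn_ord ltnNge leq_addr.
  rewrite det_lblock; congr (_ * _); congr (\det _); apply/matrixP=> i j.
    by rewrite !mxE !memS /= !ltn_ord /join !(unsplitK (inl _)).
  by rewrite !mxE !memS /= !ltnNge !leq_addr /join !(unsplitK (inr _)).
rewrite (det_mask_straighten _ K0) //; last by rewrite cardS addKn.
apply: (Psum) => i; rewrite inE => NSi; apply: (Psum) => T _; apply: (PZ).
have [cardT|cardT] := eqVneq #|T| u.+1; last first.
  rewrite det_mask_mx big_pred0 // => s; apply: contraNF cardT => /eqP<-.
  by rewrite card_imset ?cardsU1 ?NSi ?cardS //; apply: perm_inj.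
have cardS' : #|i |: S| = u.+1 by rewrite cardsU1 NSi cardS.
have [b [a [c [a' [c' ->]]]]] := det_mask_mx_prod M (addSnnS u v) cardS' cardT.
rewrite -scaler_signl; apply: (PZ).
by rewrite /M -!mxsub_comp; apply: Pprod.
Qed.

(** Row and column selections need not be increasing here: a repetition makes
    the determinant vanish, and sorting only changes its sign. *)
Lemma det_mxsub_minor (K : fieldType) (m n t : nat) (f : 'I_t -> 'I_m)
    (g : 'I_t -> 'I_n) :
  minor_algebra t (\det (mxsub f g (Defs.genmx K m n))).
Proof.
have [/injectiveP injf|] := boolP (injectiveb f); last first.
  case/injectivePn=> i [j ij fij].
  rewrite (determinant_alternate ij) => [|k]; last by rewrite !mxE fij.
  by rewrite -(scale0r 1); apply: subalg_gen_scalar.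
have [/injectiveP injg|] := boolP (injectiveb g); last first.
  case/injectivePn=> i [j ij gij].
  rewrite -det_tr (determinant_alternate ij) => [|k]; last by rewrite !mxE gij.
  by rewrite -(scale0r 1); apply: subalg_gen_scalar.
have sortP k (h : 'I_t -> 'I_k) : injective h ->
    exists2 s : 'I_t -> 'I_t, injective s & {homo h \o s : a b / (a < b)%N}.
  move=> injh; pose tp := [tuple h i | i < t].
  pose le (a b : 'I_k) := (a <= b)%N.
  have le_total : total le by move=> a b; apply: leq_total.
  have /tuple_permP[s Ds] : perm_eq (sort_tuple le tp) tp by rewrite perm_sort.
  exists s => [|a b ab /=]; first exact: perm_inj.
  have hs c : h (s c) = tnth (sort_tuple le tp) c.
    by rewrite (val_inj Ds) !tnth_mktuple.
  rewrite ltn_neqAle; apply/andP; split.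
    apply: contraTneq ab => /val_inj/injh/perm_inj->.
    by rewrite ltnn.
  have x0 : 'I_k := h a.
  rewrite !hs !(tnth_nth x0); apply: (@sorted_leq_nth _ le).
  - by move=> x y z; apply: leq_trans.
  - by move=> x; apply: leqnn.
  - exact: sort_sorted.
  - by rewrite inE size_tuple.
  - by rewrite inE size_tuple.
  exact: ltnW.
have [s injs fs] := sortP _ _ injf; have [s' injs' gs] := sortP _ _ injg.
have [b ->] := det_mxsub_inj (mxsub f g (Defs.genmx K m n)) injs injs'.
rewrite -scaler_signl -[X in _ *: X]mul1r scalerAl.
apply: subalg_gen_mul; first exact: subalg_gen_scalar.
by apply: subalg_gen_in; exists (f \o s), (g \o s'); rewrite mxsub_comp.
Qed.

(** * Products of minors of average size t *)

(** Selections that are not increasing are included, as these arise when minors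
    are straightened. *)
Definition generic_minor (K : fieldType) (m n k : nat) (p : {mpoly K[m * n]}) :
    Prop :=
  exists (f : 'I_k -> 'I_m) (g : 'I_k -> 'I_n),
    p = \det (mxsub f g (Defs.genmx K m n)).

Lemma subalg_gen_prod (K : fieldType) (A : algType K) (S : A -> Prop)
    (I : eqType) (r : seq I) (F : I -> A) :
  (forall i, i \in r -> subalg_gen S (F i)) ->
  subalg_gen S (\prod_(i <- r) F i).
Proof.
move=> SF; rewrite big_seq; apply: big_ind SF; last exact: subalg_gen_mul.
by rewrite -(scale1r 1); apply: subalg_gen_scalar.
Qed.

Lemma subalg_gen_scale (K : fieldType) (A : algType K) (S : A -> Prop)
    (c : K) (p : A) :
  subalg_gen S p -> subalg_gen S (c *: p).
Proof.
move=> Sp; rewrite -[p]mul1r scalerAl; apply: subalg_gen_mul => //.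
exact: subalg_gen_scalar.
Qed.

(** Induction on the total excess of the sizes over t.  If some size exceeds t
    then another one is below t, since the average is t, and balancing the two
    lowers the excess. *)
Lemma generic_minor_prod_algebra (K : fieldType) (m n t : nat)
    (ps : seq (nat * {mpoly K[m * n]})) :
    [pchar K] =i pred0 ->
    (forall x, x \in ps -> generic_minor x.1 x.2) ->
    (\sum_(x <- ps) x.1 = t * size ps)%N ->
  minor_algebra t (\prod_(x <- ps) x.2).
Proof.
pose excess (l : seq (nat * {mpoly K[m * n]})) := (\sum_(x <- l) (x.1 - t))%N.
move=> K0; have [e] : {e | excess ps = e} by exists (excess ps).
rewrite /excess {excess}; elim: e ps => [|e IHe] ps exc ps_min sum_ps.
  have le_t x : x \in ps -> (x.1 <= t)%N.
    move=> x_ps; move/eqP: exc; rewrite sum_nat_seq_eq0 => /allP/(_ x x_ps) /=.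
    by rewrite subn_eq0.
  have: (\sum_(x <- ps) (t - x.1) == 0)%N.
    rewrite big_seq sumnB; last by move=> x /le_t.
    rewrite -!big_seq sum_ps big_const_seq count_predT iter_addn_0 mulnC.
    by rewrite subnn.
  rewrite sum_nat_seq_eq0 => /allP ge_t.
  apply: subalg_gen_prod => x x_ps.
  have := ps_min x x_ps; have -> : x.1 = t.
    by apply/eqP; rewrite eqn_leq le_t //= -subn_eq0; have /= := ge_t x x_ps.
  by move=> [f [g ->]]; apply: det_mxsub_minor.
have [y y_ps y_gt]: exists2 y, y \in ps & (t < y.1)%N.
  apply/hasP; rewrite -[has _ _]negbK -all_predC; apply/negP=> /allP le_t.
  move: exc; rewrite big_seq big1 // => x /le_t /=; lia.
have [x x_ps x_lt]: exists2 x, x \in ps & (x.1 < t)%N.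
  apply/hasP; rewrite -[has _ _]negbK -all_predC; apply/negP=> /allP ge_t.
  have: (\sum_(x <- ps) (x.1 - t) = 0)%N; last by rewrite exc.
  rewrite big_seq sumnB; last by move=> x /ge_t /=; rewrite -leqNgt.
  rewrite -!big_seq sum_ps big_const_seq count_predT iter_addn_0 mulnC.
  by rewrite subnn.
have neq_xy : y != x by apply: contraTneq y_gt => ->; rewrite -leqNgt ltnW.
pose rest := rem y (rem x ps).
have ps_perm : perm_eq ps [:: x, y & rest].
  by rewrite (perm_trans (perm_to_rem x_ps)) // perm_cons perm_to_rem ?rem_mem.
have rest_min z : z \in rest -> generic_minor z.1 z.2.
  by move=> z_rest; apply: ps_min; rewrite (perm_mem ps_perm) !inE z_rest !orbT.
move: (ps_min x x_ps) (ps_min y y_ps) exc sum_ps.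
rewrite !(perm_big _ ps_perm) (perm_size ps_perm) !big_cons /= mulrA.
case: x y x_lt y_gt {x_ps y_ps neq_xy ps_perm} @rest rest_min.
move=> u p [[|v] q] //= u_lt v_gt; set rest := rem _ _ => rest_min.
case=> [f [g ->]] [f' [g' ->]] exc sum_ps.
apply: (@minor_product_balance _ _ _ _ _
  (fun r => minor_algebra t (r * \prod_(z <- rest) z.2))) K0 _ _ _ _ _.
- by lia.
- rewrite mul0r -(scale0r 1); exact: subalg_gen_scalar.
- by move=> r r' Pr Pr'; rewrite mulrDl; apply: subalg_gen_add.
- by move=> c r Pr; rewrite -scalerAl; apply: subalg_gen_scale.
move=> a b a' b'; pose w := \det (mxsub a b (Defs.genmx K m n)).
pose w' := \det (mxsub a' b' (Defs.genmx K m n)).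
have := IHe ((u.+1, w) :: (v, w') :: rest); rewrite !big_cons /= mulrA; apply.
- by move: exc; lia.
- move=> z; rewrite !inE => /or3P[/eqP->|/eqP->|/rest_min //].
    by exists a, b.
  by exists a', b'.
by move: sum_ps; lia.
Qed.

(** * Unitriangular invariance of leading minors *)

Definition leading_minor (R : comNzRingType) (m n s : nat) (hm : (s <= m)%N)
    (hn : (s <= n)%N) (X : 'M[R]_(m, n)) : R :=
  \det (mxsub (widen_ord hm) (widen_ord hn) X).

(** The first s rows of A *m X involve only the first s rows of X, through the
    unitriangular upper left block of A. *)
Lemma leading_minor_mulmxl (R : comNzRingType) (m n s : nat) (hm : (s <= m)%N)
    (hn : (s <= n)%N) (A : 'M[R]_m) (X : 'M[R]_(m, n)) :
    is_trig_mx A -> (forall i, A i i = 1) ->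
  leading_minor hm hn (A *m X) = leading_minor hm hn X.
Proof.
move=> /is_trig_mxP A_trig A_diag; rewrite /leading_minor.
pose As := mxsub (widen_ord hm) (widen_ord hm) A.
have -> : mxsub (widen_ord hm) (widen_ord hn) (A *m X)
    = As *m mxsub (widen_ord hm) (widen_ord hn) X.
  apply/matrixP=> i j; rewrite !mxE.
  rewrite (bigID (fun k : 'I_m => (k < s)%N)) /= [X in _ + X]big1 ?addr0.
    by rewrite big_ord_narrow; apply: eq_bigr => k _; rewrite !mxE.
  move=> k; rewrite -leqNgt => le_sk.
  by rewrite A_trig ?mul0r ?(leq_trans _ le_sk) /=.
rewrite det_mulmx det_trig => [|]; last first.
  by apply/is_trig_mxP=> i j ij; rewrite mxE A_trig.
by rewrite big1 ?mul1r // => i _; rewrite mxE A_diag.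
Qed.

Lemma leading_minor_tr (R : comNzRingType) (m n s : nat) (hm : (s <= m)%N)
    (hn : (s <= n)%N) (X : 'M[R]_(m, n)) :
  leading_minor hn hm X^T = leading_minor hm hn X.
Proof. by rewrite /leading_minor -trmx_mxsub det_tr. Qed.

Lemma leading_minor_mulmxr (R : comNzRingType) (m n s : nat) (hm : (s <= m)%N)
    (hn : (s <= n)%N) (B : 'M[R]_n) (X : 'M[R]_(m, n)) :
    is_trig_mx B^T -> (forall i, B i i = 1) ->
  leading_minor hm hn (X *m B) = leading_minor hm hn X.
Proof.
move=> B_trig B_diag; rewrite -leading_minor_tr trmx_mul.
by rewrite leading_minor_mulmxl ?leading_minor_tr // => i; rewrite mxE.
Qed.

Lemma upper_unitriangular_unit (K : fieldType) (r : nat) (B : 'M[K]_r) :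
  upper_unitriangular B -> B \in unitmx.
Proof.
case=> B_trig B_diag; rewrite -unitmx_tr unitmxE det_trig //.
by rewrite big1 ?unitr1.
Qed.

Lemma gl_act_genmx (K : fieldType) (m n : nat) (A : 'M[K]_m) (B : 'M[K]_n) :
  map_mx (gl_act A B) (Defs.genmx K m n) =
    map_mx (@mpolyC (m * n) K) A *m Defs.genmx K m n
      *m map_mx (@mpolyC (m * n) K) (invmx B).
Proof.
apply/matrixP=> i j; rewrite [LHS]mxE [X in gl_act _ _ X]mxE /gl_act.
by rewrite comp_mpolyXU -tnth_nth tnth_mktuple mxvecE.
Qed.

Lemma initial_minor_invariant (K : fieldType) (m n : nat) (hmn : (m <= n)%N)
    (s : 'I_m.+1) :
  U_invariant (initial_minor K hmn s).
Proof.
move=> A B [A_trig A_diag] uB; have uniB := upper_unitriangular_unit uB.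
case: uB => B_trig B_diag.
pose X := Defs.genmx K m n.
have -> : gl_act A B (initial_minor K hmn s) = leading_minor (leq_ord s)
    (leq_trans (leq_ord s) hmn) (map_mx (gl_act A B) X).
  by rewrite /leading_minor -map_mxsub det_map_mx.
rewrite gl_act_genmx.
rewrite -(@leading_minor_mulmxr _ _ _ _ _ _ (map_mx (@mpolyC (m * n) K) B)).
- rewrite -(mulmxA _ (map_mx _ (invmx B))) -map_mxM mulVmx // map_mx1 mulmx1.
  rewrite leading_minor_mulmxl //.
    by apply/is_trig_mxP=> i j ij; rewrite mxE (is_trig_mxP A_trig) // mpolyC0.
  by move=> i; rewrite mxE A_diag mpolyC1.
- apply/is_trig_mxP=> i j ij; move/is_trig_mxP: B_trig => /(_ i j ij).
  by rewrite !mxE => ->; rewrite mpolyC0.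
by move=> i; have := B_diag i; rewrite !mxE => ->; rewrite mpolyC1.
Qed.

Lemma initial_minor_prod_invariant (K : fieldType) (m n : nat) (hmn : (m <= n)%N)
    (lam : seq 'I_m.+1) :
  U_invariant (initial_minor_prod K hmn lam).
Proof.
move=> A B lA uB; rewrite /gl_act rmorph_prod; apply: eq_bigr => s _.
exact: initial_minor_invariant.
Qed.

(** * Generic matrices over an infinite field *)

Lemma digits_inj (n b : nat) (f g : 'I_n -> nat) :
    (forall i, (f i < b)%N) -> (forall i, (g i < b)%N) ->
    (\sum_(i < n) f i * b ^ i = \sum_(i < n) g i * b ^ i)%N ->
  f =1 g.
Proof.
elim: n f g => [|n IHn] f g f_lt g_lt; first by move=> _ [].
have shift (h : 'I_n.+1 -> nat) : (\sum_(i < n.+1) h i * b ^ i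
    = (\sum_(i < n) h (lift ord0 i) * b ^ i) * b + h ord0)%N.
  rewrite big_ord_recl expn0 muln1 addnC big_distrl; congr addn.
  by apply: eq_bigr => i _; rewrite expnSr mulnA.
have b_gt0 : (0 < b)%N by apply: leq_ltn_trans (f_lt ord0).
rewrite !shift => eq_fg; have eq0 : f ord0 = g ord0.
  by have := congr1 (modn^~ b) eq_fg; rewrite !modnMDl !modn_small.
move/eqP: eq_fg; rewrite eq0 eqn_add2r eqn_pmul2r // => /eqP eq_fg i.
have [j ->|->//] := unliftP ord0 i.
exact: (IHn (f \o lift ord0) (g \o lift ord0)
  (fun _ => f_lt _) (fun _ => g_lt _) eq_fg).
Qed.

Lemma poly_vanish_eq0 (K : fieldType) (q : {poly K}) :
  [pchar K] =i pred0 -> (forall z, q.[z] = 0) -> q = 0.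
Proof.
move=> /pcharf0P K0 q0; apply/eqP; apply: contraT => nz_q.
pose zs : seq K := [seq i%:R | i <- iota 0 (size q)].
have := max_poly_roots nz_q (rs := zs); rewrite size_map size_iota ltnn => -> //.
  by apply/allP=> z _; apply/eqP/q0.
rewrite map_inj_uniq ?iota_uniq // => i j.
wlog le_ij: i j / (i <= j)%N => [W|] eq_ij.
  by case/orP: (leq_total i j) => [/W|/W H]; [apply|apply/esym/H].
apply/eqP; rewrite eqn_leq le_ij /= -subn_eq0 -K0 natrB // subr_eq0.
by rewrite eq_ij.
Qed.

(** Kronecker substitution: at the points (z, z^b, z^(b^2), ...) with b larger
    than all exponents, distinct monomials become distinct powers of z, so the
    claim reduces to one variable. *)
Lemma mpoly_vanish_eq0 (K : fieldType) (k : nat) (p : {mpoly K[k]}) :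
  [pchar K] =i pred0 -> (forall v : 'I_k -> K, p.@[v] = 0) -> p = 0.
Proof.
move=> K0 p0; pose b := msize p.
pose code (e : 'X_{1..k}) := (\sum_(i < k) e i * b ^ i)%N.
pose q : {poly K} := \sum_(e <- msupp p) p@_e *: 'X^(code e).
have q0 : q = 0.
  apply: (poly_vanish_eq0 K0) => z.
  rewrite -[RHS](p0 (fun i => z ^+ (b ^ i))) mevalE /q horner_sum.
  apply: eq_bigr => e _; rewrite hornerZ hornerXn; congr (_ * _).
  rewrite /code -prodrXr; apply: eq_bigr => i _.
  by rewrite -exprM mulnC.
apply/eqP; rewrite -msupp_eq0; case p_supp: (msupp p) => [//|e0 s].
have e0_in : e0 \in msupp p by rewrite p_supp mem_head.
have := e0_in; rewrite mcoeff_msupp => /eqP[]; rewrite -[RHS](coef0 _ (code e0)) -q0.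
rewrite /q coef_sum (bigD1_seq e0) ?msupp_uniq //= coefZ coefXn eqxx mulr1.
rewrite big1_seq ?addr0 // => e /andP[ne_e e_in]; rewrite coefZ coefXn.
case: eqP => [eq_code|]; last by rewrite mulr0.
case/eqP: ne_e; apply/mnmP=> i.
have lt_b (e' : 'X_{1..k}) : e' \in msupp p -> forall j, (e' j < b)%N.
  move=> /msize_mdeg_lt lt_e' j; apply: leq_ltn_trans lt_e'.
  by rewrite mdegE (bigD1 j) //= leq_addr.
exact: (digits_inj (lt_b _ e_in) (lt_b _ e0_in) (esym eq_code)).
Qed.

Lemma leading_minor_block (R : comNzRingType) (m n s : nat) (a : 'M[R]_1)
    (r : 'rV[R]_n) (X : 'M[R]_(m, n)) (hm : (1 + s <= 1 + m)%N)
    (hn : (1 + s <= 1 + n)%N) (hm' : (s <= m)%N) (hn' : (s <= n)%N) :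
  leading_minor hm hn (block_mx a r 0 X) = a 0 0 * leading_minor hm' hn' X.
Proof.
have wl p (hp : (1 + s <= 1 + p)%N) i : widen_ord hp (lshift s i) = lshift p i.
  exact: val_inj.
have wr p (hp : (1 + s <= 1 + p)%N) (hp' : (s <= p)%N) i :
    widen_ord hp (rshift 1 i) = rshift 1 (widen_ord hp' i).
  exact: val_inj.
rewrite {1}/leading_minor -(submxK (mxsub _ _ _)) (_ : dlsubmx _ = 0); last first.
  apply/matrixP=> i j; rewrite dlsubmxEsub 2!mxE (wr _ hm hm') wl.
  by rewrite block_mxEdl 2!mxE.
rewrite det_ublock det_mx11; congr (_ * _).
  by rewrite ulsubmxEsub 2!mxE !wl block_mxEul.
rewrite /leading_minor; congr (\det _); apply/matrixP=> i j.
by rewrite drsubmxEsub 2!mxE (wr _ hm hm') (wr _ hn hn') block_mxEdr mxE.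
Qed.

(** Gaussian elimination without pivoting, written A *m X = D *m B so that no
    inverse has to be shown unitriangular.  The nonvanishing of the leading
    minors provides the pivots and passes to the Schur complement by
    [leading_minor_block]. *)
Lemma unitriangular_diagonalization (K : fieldType) (m n : nat)
    (X : 'M[K]_(m, n)) :
    (m <= n)%N ->
    (forall s (hm : (s <= m)%N) (hn : (s <= n)%N), leading_minor hm hn X != 0) ->
  exists (A : 'M[K]_m) (B : 'M[K]_n) (D : 'M[K]_(m, n)),
    [/\ lower_unitriangular A, upper_unitriangular B,
        forall (i : 'I_m) (j : 'I_n), (i != j :> nat) -> D i j = 0 & A *m X = D *m B].
Proof.
elim: m n X => [|m IHm] n X le_mn X_reg.
  exists 1%:M, 1%:M, 0; split.
  - by split=> [|[]//]; apply/is_trig_mxP; case.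
  - split=> [|i]; last by rewrite trmx1 mxE eqxx.
    by apply/is_trig_mxP=> i j ij; rewrite trmx1 mxE -val_eqE ltn_eqF.
  - by case.
  by apply/matrixP; case.
case: n X le_mn X_reg => // n; rewrite -[in m.+1]add1n -[in n.+1]add1n => X.
rewrite leq_add2l => le_mn X_reg.
pose a := ulsubmx X; pose r := ursubmx X; pose c := dlsubmx X.
have a_unit : a \in unitmx.
  have hm : (1 <= 1 + m)%N by [].
  have hn : (1 <= 1 + n)%N by [].
  rewrite unitmxE unitfE; have := X_reg 1%N hm hn.
  rewrite /leading_minor; congr (\det _ != 0); apply/matrixP=> i j.
  by rewrite !mxE; congr (X _ _); apply: val_inj.
pose X' := drsubmx X - c *m invmx a *m r.
have block_lower p (A : 'M[K]_p) (x : 'cV[K]_p) : lower_unitriangular A ->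
    lower_unitriangular (block_mx (1%:M : 'M_1) 0 x A).
  case=> A_trig A_diag; split=> [|i].
    by rewrite is_trig_block_mx // eqxx mx11_is_trig.
  by case: (split_ordP i) => j ->; rewrite ?block_mxEul ?block_mxEdr ?mxE ?eqxx.
have one_lower : lower_unitriangular (1%:M : 'M[K]_m).
  by split=> [|i]; rewrite ?scalar_mx_is_trig ?mxE ?eqxx.
(* X' is the Schur complement of the pivot; A = 1 is one elimination step. *)
have clear_border (A : 'M[K]_m) :
    block_mx 1%:M 0 (- (A *m (c *m invmx a))) A *m X = block_mx a r 0 (A *m X').
  rewrite -[in LHS](submxK X) mulmx_block !mul1mx !mul0mx !addr0 -/a -/r -/c.
  rewrite !mulNmx -!mulmxA mulVmx // mulmx1 addNr; congr block_mx.
  by rewrite /X' mulmxBr addrC !mulmxA.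
have [s hm hn|A' [B' [D' [uA uB D_diag eqAX]]]] := IHm _ X' le_mn.
- have hm1 : (1 + s <= 1 + m)%N by [].
  have hn1 : (1 + s <= 1 + n)%N by [].
  have [L_trig L_diag] := block_lower _ _ (- (1%:M *m (c *m invmx a))) one_lower.
  have := X_reg _ hm1 hn1; rewrite -(leading_minor_mulmxl _ _ _ L_trig L_diag).
  by rewrite clear_border mul1mx leading_minor_block mulf_eq0 negb_or => /andP[].
exists (block_mx 1%:M 0 (- (A' *m (c *m invmx a))) A').
exists (block_mx 1%:M (invmx a *m r) 0 B'), (block_mx a 0 0 D'); split.
- exact: block_lower.
- by rewrite /upper_unitriangular tr_block_mx trmx0 trmx1; apply: block_lower.
- move=> i j; case: (split_ordP i) => i' ->; case: (split_ordP j) => j' ->.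
  + by rewrite !ord1 eqxx.
  + by rewrite block_mxEur mxE.
  + by rewrite block_mxEdl mxE.
  by rewrite block_mxEdr /= eqn_add2l; apply: D_diag.
rewrite clear_border mulmx_block !mul0mx !mulmx0 !addr0 !add0r mulmx1 mulmxA.
by rewrite mulmxV // mul1mx eqAX.
Qed.

(** * Invariants are polynomials in the initial minors *)

(** First column y and entries -1 above the diagonal.  The leading minors of
    this matrix are the entries of y themselves, which makes it a polynomial
    section of the map taking the leading minors. *)
Definition section_mx (R : comNzRingType) (m n : nat) (y : 'I_m -> R) :
    'M[R]_(m, n) :=
  \matrix_(i, j) (if (j == 0 :> nat) then y i else - (j == i.+1 :> nat)%:R).

Lemma leading_minor0 (R : comNzRingType) (m n : nat) (hm : (0 <= m)%N)
    (hn : (0 <= n)%N) (X : 'M[R]_(m, n)) :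
  leading_minor hm hn X = 1.
Proof. exact: det_mx00. Qed.

(** Expand along the last row, whose only nonzero entry is the first one; the
    complementary minor is that of a scalar matrix -1, and the two signs
    cancel. *)
Lemma leading_minor_section (R : comNzRingType) (m n : nat) (y : 'I_m -> R)
    (i : 'I_m) (hm : (i.+1 <= m)%N) (hn : (i.+1 <= n)%N) :
  leading_minor hm hn (section_mx n y) = y i.
Proof.
rewrite /leading_minor (expand_det_row _ ord_max) (bigD1 ord0) //= big1 => [|j j0].
  rewrite addr0 !mxE /= /cofactor (_ : row' _ _ = (-1)%:M); last first.
    apply/matrixP=> a b; rewrite !mxE /= /bump !leq0n add1n eqSS leqNgt ltn_ord.
    by rewrite add0n -val_eqE eq_sym; case: eqP => _; rewrite ?mulr1n ?mulr0n ?oppr0.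
  rewrite det_scalar addn0 mulrA -mulrA -exprMn mulrNN mulr1 expr1n mulr1.
  by congr y; apply: val_inj.
rewrite !mxE /= -val_eqE /= in j0 *; rewrite (negPf j0) ltn_eqF ?ltn_ord //.
by rewrite oppr0 mul0r.
Qed.

Lemma diagonal_leading_minor (R : comNzRingType) (m n s : nat) (hm : (s <= m)%N)
    (hn : (s <= n)%N) (D : 'M[R]_(m, n)) :
    (forall (i : 'I_m) (j : 'I_n), (i != j :> nat) -> D i j = 0) ->
  leading_minor hm hn D = \prod_(i < s) D (widen_ord hm i) (widen_ord hn i).
Proof.
move=> D_diag; rewrite /leading_minor det_trig.
  by apply: eq_bigr => i _; rewrite mxE.
by apply/is_trig_mxP=> i j ij; rewrite mxE D_diag //= neq_ltn ij.
Qed.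

(** The diagonal entries are the quotients of consecutive leading minors. *)
Lemma diagonal_determined (K : fieldType) (m n : nat) (D E : 'M[K]_(m, n)) :
    (m <= n)%N ->
    (forall (i : 'I_m) (j : 'I_n), (i != j :> nat) -> D i j = 0) ->
    (forall (i : 'I_m) (j : 'I_n), (i != j :> nat) -> E i j = 0) ->
    (forall s (hm : (s <= m)%N) (hn : (s <= n)%N), leading_minor hm hn D != 0) ->
    (forall s (hm : (s <= m)%N) (hn : (s <= n)%N),
       leading_minor hm hn D = leading_minor hm hn E) ->
  D = E.
Proof.
move=> le_mn D_diag E_diag D_reg eqDE; apply/matrixP=> i j.
have [eq_ij|ne_ij] := eqVneq (i : nat) (j : nat); last first.
  by rewrite D_diag ?E_diag.
have hm : (i < m)%N := ltn_ord i; have hn := leq_trans hm le_mn.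
have hm' := ltnW hm; have hn' := ltnW hn.
have split_last (F : 'M[K]_(m, n)) :
    (forall (i : 'I_m) (j : 'I_n), (i != j :> nat) -> F i j = 0) ->
    leading_minor hm hn F = leading_minor hm' hn' F * F i j.
  move=> F_diag; rewrite !diagonal_leading_minor // big_ord_recr /=; congr (_ * _).
    by apply: eq_bigr => k _; congr (F _ _); apply: val_inj.
  by congr (F _ _); apply: val_inj; rewrite /= -?eq_ij.
have := eqDE _ hm hn; rewrite !split_last // -(eqDE _ hm' hn').
exact: (mulfI (D_reg _ hm' hn')).
Qed.

Lemma meval_genmx (K : fieldType) (m n : nat) (X : 'M[K]_(m, n)) :
  map_mx (meval (fun k => mxvec X 0 k)) (Defs.genmx K m n) = X.
Proof. by apply/matrixP=> i j; rewrite !mxE mevalXU mxvecE. Qed.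

Lemma meval_gl_act (K : fieldType) (m n : nat) (A : 'M[K]_m) (B : 'M[K]_n)
    (X : 'M[K]_(m, n)) (p : {mpoly K[m * n]}) :
  (gl_act A B p).@[fun k => mxvec X 0 k] =
    p.@[fun k => mxvec (A *m X *m invmx B) 0 k].
Proof.
rewrite comp_mpoly_meval; apply: meval_eq => k; rewrite tnth_mktuple.
have constK r s (C : 'M[K]_(r, s)) :
    map_mx (meval (fun k => mxvec X 0 k)) (map_mx (@mpolyC (m * n) K) C) = C.
  by apply/matrixP=> i j; rewrite !mxE mevalC.
have <- : map_mx (meval (fun k => mxvec X 0 k))
    (map_mx (@mpolyC (m * n) K) A *m Defs.genmx K m n
      *m map_mx (@mpolyC (m * n) K) (invmx B)) = A *m X *m invmx B.
  by rewrite !map_mxM !constK meval_genmx.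
by case: (mxvec_indexP k) => i j; rewrite !mxvecE [RHS]mxE.
Qed.

(** Matrices with the same nonzero leading minors are equivalent to the same
    diagonal matrix, because unitriangular factors preserve these minors. *)
Lemma invariant_meval_eq (K : fieldType) (m n : nat) (X Y : 'M[K]_(m, n))
    (p : {mpoly K[m * n]}) :
    (m <= n)%N -> U_invariant p ->
    (forall s (hm : (s <= m)%N) (hn : (s <= n)%N), leading_minor hm hn X != 0) ->
    (forall s (hm : (s <= m)%N) (hn : (s <= n)%N),
       leading_minor hm hn X = leading_minor hm hn Y) ->
  p.@[fun k => mxvec X 0 k] = p.@[fun k => mxvec Y 0 k].
Proof.
move=> le_mn p_inv X_reg eqXY.
have Y_reg s (hm : (s <= m)%N) (hn : (s <= n)%N) : leading_minor hm hn Y != 0.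
  by rewrite -eqXY.
have [A [B [D [uA uB D_diag AX]]]] := unitriangular_diagonalization le_mn X_reg.
have [A' [B' [D' [uA' uB' D'_diag AY]]]] := unitriangular_diagonalization le_mn Y_reg.
have minorD (A0 : 'M[K]_m) B0 X0 D0 s (hm : (s <= m)%N) (hn : (s <= n)%N) :
    lower_unitriangular A0 -> upper_unitriangular B0 -> A0 *m X0 = D0 *m B0 ->
    leading_minor hm hn X0 = leading_minor hm hn D0.
  case=> A_trig A_diag [B_trig B_diag] AX0.
  rewrite -(leading_minor_mulmxl _ _ _ A_trig A_diag) AX0 leading_minor_mulmxr //.
  by move=> i; have := B_diag i; rewrite mxE.
have eqD : D = D'.
  apply: (diagonal_determined le_mn) => // s hm hn.
    by rewrite -(minorD _ _ _ _ _ hm hn uA uB AX).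
  rewrite -(minorD _ _ _ _ _ hm hn uA uB AX) eqXY.
  exact: (minorD _ _ _ _ _ hm hn uA' uB' AY).
rewrite -[in LHS](p_inv _ _ uA uB) -[in RHS](p_inv _ _ uA' uB') !meval_gl_act.
by rewrite AX AY !mulmxK ?upper_unitriangular_unit // eqD.
Qed.

Lemma meval_initial_minor (K : fieldType) (m n : nat) (hmn : (m <= n)%N)
    (s : 'I_m.+1) (X : 'M[K]_(m, n)) :
  (initial_minor K hmn s).@[fun k => mxvec X 0 k] =
    leading_minor (leq_ord s) (leq_trans (leq_ord s) hmn) X.
Proof.
by rewrite /initial_minor -det_map_mx map_mxsub meval_genmx.
Qed.

(** The polynomial is q(y) = p(S(y)), for S the section of the leading minors.
    The difference p - q(delta), multiplied by the product of all the delta_s,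
    vanishes at every point. *)
Lemma invariant_initial_minors (K : fieldType) (m n : nat) (hmn : (m <= n)%N)
    (p : {mpoly K[m * n]}) :
    [pchar K] =i pred0 -> U_invariant p ->
  exists q : {mpoly K[m]},
    p = q \mPo [tuple initial_minor K hmn (lift ord0 i) | i < m].
Proof.
move=> K0 p_inv; pose delta := [tuple initial_minor K hmn (lift ord0 i) | i < m].
pose S := section_mx n (fun i : 'I_m => 'X_i : {mpoly K[m]}).
pose q := p \mPo [tuple mxvec S 0 k | k < m * n].
exists q; apply/eqP; rewrite -subr_eq0; apply/eqP.
have delta_section (y : 'I_m -> K) i :
    (tnth delta i).@[fun k => mxvec (section_mx n y) 0 k] = y i.
  by rewrite tnth_mktuple meval_initial_minor leading_minor_section.
have meval_q (y : 'I_m -> K) : q.@[y] = p.@[fun k => mxvec (section_mx n y) 0 k].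
  rewrite comp_mpoly_meval; apply: meval_eq => k; rewrite tnth_mktuple.
  case: (mxvec_indexP k) => i j; rewrite !mxvecE !mxE.
  by case: eqP; rewrite ?mevalXU // mevalN -mpolyC_nat mevalC.
(* Every initial minor takes the value 1 at the section of (1, ..., 1). *)
have delta_neq0 : \prod_(i < m) tnth delta i != 0.
  apply/eqP=> /(congr1 (meval (fun k => mxvec (section_mx n (fun=> 1 : K)) 0 k))).
  rewrite meval0 rmorph_prod big1 => [/eqP|i _]; first by rewrite oner_eq0.
  exact: delta_section.
apply: (mulIf delta_neq0); rewrite mul0r; apply: (mpoly_vanish_eq0 K0) => v.
pose X : 'M[K]_(m, n) := vec_mx (\row_k v k).
rewrite (@meval_eq _ _ _ (fun k => mxvec X 0 k)); last first.
  by move=> k; rewrite vec_mxK mxE.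
rewrite mevalM mevalB comp_mpoly_meval meval_q rmorph_prod /=.
have [->|] := eqVneq (\prod_i (tnth delta i).@[fun k => mxvec X 0 k]) 0.
  by rewrite mulr0.
move=> /prodf_neq0 reg; set Y := section_mx n _.
have minorX s (hm : (s < m)%N) (hn : (s < n)%N) (Z : 'M[K]_(m, n)) :
    leading_minor hm hn Z = (tnth delta (Ordinal hm)).@[fun k => mxvec Z 0 k].
  rewrite tnth_mktuple meval_initial_minor.
  by congr (leading_minor _ _ Z); apply: bool_irrelevance.
rewrite (@invariant_meval_eq _ _ _ X Y) ?subrr ?mul0r //.
  by case=> [|s] hm hn; rewrite ?leading_minor0 ?oner_eq0 // minorX; apply: reg.
case=> [|s] hm hn; first by rewrite !leading_minor0.
by rewrite !minorX delta_section.
Qed.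

(** * Restriction to diagonal matrices *)

Definition diagonal_mx (K : fieldType) (m n : nat) : 'M[{mpoly K[m]}]_(m, n) :=
  \matrix_(i, j) (if (i == j :> nat) then 'X_i else 0).

Definition diagonal_subst (K : fieldType) (m n : nat) (p : {mpoly K[m * n]}) :
    {mpoly K[m]} :=
  p \mPo [tuple mxvec (diagonal_mx K m n) 0 k | k < m * n].

(** The monomials of degree t * d with all exponents at most d, for some d: they
    form a monoid, which contains the squarefree monomials of degree t. *)
Definition veronese_support (K : fieldType) (m t : nat) (q : {mpoly K[m]}) :
    Prop :=
  forall e, e \in msupp q -> (t %| mdeg e)%N /\ forall i, (t * e i <= mdeg e)%N.

Lemma diagonal_subst_det (K : fieldType) (m n s : nat) (f : 'I_s -> 'I_m)
    (g : 'I_s -> 'I_n) :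
  diagonal_subst (\det (mxsub f g (Defs.genmx K m n)))
    = \det (mxsub f g (diagonal_mx K m n)).
Proof.
rewrite /diagonal_subst -det_map_mx map_mxsub; congr (\det (mxsub f g _)).
apply/matrixP=> i j; rewrite !mxE /= comp_mpolyXU -tnth_nth tnth_mktuple.
by rewrite mxvecE mxE.
Qed.

Lemma mpolyX_sum (R : nzRingType) (k : nat) (I : Type) (r : seq I)
    (P : pred I) (F : I -> 'X_{1..k}) :
  'X_[R, \sum_(i <- r | P i) F i] = \prod_(i <- r | P i) 'X_[F i].
Proof. by apply: big_morph => [e e'|]; rewrite ?mpolyXD ?mpolyX0. Qed.

Lemma veronese_supportD (K : fieldType) (m t : nat) (p q : {mpoly K[m]}) :
  veronese_support t p -> veronese_support t q -> veronese_support t (p + q).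
Proof. by move=> Vp Vq e /msuppD_le; rewrite mem_cat => /orP[/Vp|/Vq]. Qed.

Lemma veronese_supportZ (K : fieldType) (m t : nat) (c : K) (p : {mpoly K[m]}) :
  veronese_support t p -> veronese_support t (c *: p).
Proof. by move=> Vp e /msuppZ_le/Vp. Qed.

(** Each term of the determinant is zero or, up to sign, the product of the t
    distinct variables of index f i. *)
Lemma veronese_support_minor (K : fieldType) (m n t : nat) (f : 'I_t -> 'I_m)
    (g : 'I_t -> 'I_n) :
  injective f -> veronese_support t (\det (mxsub f g (diagonal_mx K m n))).
Proof.
move=> injf; rewrite /determinant.
apply: big_ind => [e|p q|s _]; [by rewrite msupp0|exact: veronese_supportD|].
rewrite -scaler_signl; apply: veronese_supportZ.
have [/forallP diag_fg|] := boolP [forall i, f i == g (s i) :> nat].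
  rewrite (eq_bigr (fun i => 'X_[U_(f i)])) => [|i _]; last first.
    by rewrite !mxE diag_fg.
  rewrite -mpolyX_sum => e; rewrite msuppX inE => /eqP->.
  have -> : mdeg (\sum_(i < t) U_(f i))%MM = t.
    rewrite mdeg_sum (eq_bigr (fun=> 1%N)) => [|i _]; last by rewrite mdeg1.
    by rewrite sum1_card card_ord.
  split=> [|k]; first exact: dvdnn.
  rewrite -[leqRHS]muln1 leq_mul2l; apply/orP; right.
  rewrite mnm_sumE (eq_bigr (fun i => (f i == k) : nat)) => [|i _]; last first.
    exact: mnm1E.
  rewrite -big_mkcond sum1_card; apply/card_le1_eqP=> a b.
  by rewrite !unfold_in => /eqP fa /eqP fb; apply/injf/val_inj; rewrite /= fa.
case/forallPn=> i fgi e; rewrite (bigD1 i) //= !mxE (negPf fgi) mul0r.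
by rewrite msupp0.
Qed.

Lemma veronese_support_algebra (K : fieldType) (m n t : nat)
    (p : {mpoly K[m * n]}) :
  minor_algebra t p -> veronese_support t (diagonal_subst p).
Proof.
elim=> [_ [f [g [f_incr _ ->]]]|c|x y _ Vx _ Vy|x y _ Vx _ Vy].
- rewrite diagonal_subst_det; apply: veronese_support_minor => a b fab.
  by case: (ltngtP a b) => [/f_incr|/f_incr|/val_inj //]; rewrite fab ltnn.
- rewrite /diagonal_subst comp_mpolyZ comp_mpoly1.
  apply: veronese_supportZ => e; rewrite msupp1 inE => /eqP->; rewrite mdeg0.
  by split=> // i; rewrite mnm0E muln0.
- by rewrite /diagonal_subst comp_mpolyD; apply: veronese_supportD.
rewrite /diagonal_subst rmorphM => e /msuppM_le/allpairsP[[e1 e2] /= [e1x e2y ->]].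
have [[d1 le1] [d2 le2]] := (Vx e1 e1x, Vy e2 e2y).
rewrite mdegD dvdn_add //; split=> // i; rewrite mnmDE mulnDr.
exact: leq_add.
Qed.

(** * Products of initial minors *)

(** If a lists the multiplicities of the parts of a partition, a j being that of
    the part j + 1, then these are the parts of the conjugate partition: the
    exponents of the diagonal entries in the product of initial minors. *)
Definition conjugate_mnm (m : nat) (a : 'X_{1..m}) : 'X_{1..m} :=
  [multinom (\sum_(j < m | (i <= j)%N) a j)%N | i < m].

(** Multiplicities are the differences of consecutive parts of the conjugate. *)
Lemma conjugate_mnm_inj (m : nat) : injective (@conjugate_mnm m).
Proof.
move=> a b eq_ab; apply/mnmP=> i.
pose tail (c : 'X_{1..m}) (k : nat) := (\sum_(j < m | (k <= j)%N) c j)%N.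
have eq_tail k : tail a k = tail b k.
  have [lt_km|le_mk] := ltnP k m.
    by have := congr1 (fun e : 'X_{1..m} => e (Ordinal lt_km)) eq_ab; rewrite !mnmE.
  have no_j (j : 'I_m) : (k <= j)%N = false.
    by rewrite leqNgt (leq_trans (ltn_ord j) le_mk).
  by rewrite /tail !big_pred0.
have tailS c : tail c i = (c i + tail c i.+1)%N.
  rewrite /tail (bigD1 i) //=; congr addn; apply: eq_bigl => j.
  by rewrite ltn_neqAle andbC eq_sym.
by have := eq_tail i; rewrite !tailS eq_tail => /addIn.
Qed.

Lemma mdeg_conjugate (m : nat) (a : 'X_{1..m}) :
  mdeg (conjugate_mnm a) = (\sum_(j < m) j.+1 * a j)%N.
Proof.
rewrite mdegE; under eq_bigr do rewrite mnmE.
rewrite (exchange_big_dep xpredT) //=; apply: eq_bigr => j _.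
rewrite sum_nat_const; congr (_ * _)%N.
rewrite (eq_card (B := [pred i : 'I_m | (i < j.+1)%N])) //.
by rewrite -sum1_card (big_ord_narrow (ltn_ord j)) sum1_card card_ord.
Qed.

Lemma diagonal_subst_initial_minor (K : fieldType) (m n : nat)
    (hmn : (m <= n)%N) (j : 'I_m) :
  diagonal_subst (initial_minor K hmn (lift ord0 j)) =
    \prod_(i < m | (i <= j)%N) 'X_i.
Proof.
rewrite diagonal_subst_det -/(leading_minor _ _ _) diagonal_leading_minor.
  rewrite (big_ord_narrow (ltn_ord j)); apply: eq_bigr => i _.
  by rewrite mxE eqxx; congr ('X_ _); apply: val_inj.
by move=> i k ik; rewrite mxE (negPf ik).
Qed.

Lemma diagonal_subst_initial_minors (K : fieldType) (m n : nat)
    (hmn : (m <= n)%N) (a : 'X_{1..m}) :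
  diagonal_subst (\prod_(j < m) initial_minor K hmn (lift ord0 j) ^+ a j) =
    'X_[conjugate_mnm a].
Proof.
rewrite /diagonal_subst rmorph_prod mpolyXE_id.
transitivity (\prod_(j < m) \prod_(i < m | (i <= j)%N) ('X_i : {mpoly K[m]}) ^+ a j).
  apply: eq_bigr => j _; rewrite rmorphXn /= prodrXl; congr (_ ^+ _).
  exact: diagonal_subst_initial_minor.
rewrite (exchange_big_dep xpredT) //=; apply: eq_bigr => i _.
by rewrite mnmE prodrXr.
Qed.

(** By injectivity of [conjugate_mnm] no cancellation occurs on diagonal
    matrices, so each a in the support of q gives a monomial to which
    [veronese_support_algebra] applies; its first exponent is the number of
    parts. *)
Lemma initial_minors_in_algebra_support (K : fieldType) (m n t : nat)
    (hmn : (m <= n)%N) (q : {mpoly K[m]}) (a : 'X_{1..m}) :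
    minor_algebra t (q \mPo [tuple initial_minor K hmn (lift ord0 i) | i < m]) ->
    a \in msupp q -> (0 < m)%N ->
  (t %| \sum_(j < m) j.+1 * a j)%N /\
    (t * (\sum_(j < m) a j) <= \sum_(j < m) j.+1 * a j)%N.
Proof.
move=> /veronese_support_algebra Vq a_q m_gt0.
have [|dvd_t le_t] := Vq (conjugate_mnm a).
  have -> : diagonal_subst (q \mPo [tuple initial_minor K hmn (lift ord0 i) | i < m])
      = \sum_(b <- msupp q) q@_b *: 'X_[conjugate_mnm b].
    rewrite comp_mpolyEX /diagonal_subst (raddf_sum (comp_mpoly _)) /=.
    apply: eq_bigr => b _; rewrite comp_mpolyZ comp_mpolyX; congr (_ *: _).
    under eq_bigr do rewrite tnth_mktuple.
    exact: diagonal_subst_initial_minors.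
  rewrite mcoeff_msupp raddf_sum (bigD1_seq a) ?msupp_uniq //= mcoeffZ mcoeffX.
  rewrite eqxx mulr1 big1 ?addr0 -?mcoeff_msupp // => b ne_b.
  by rewrite mcoeffZ mcoeffX (inj_eq (@conjugate_mnm_inj m)) (negPf ne_b) mulr0.
split; first by rewrite -mdeg_conjugate.
by have := le_t (Ordinal m_gt0); rewrite mdeg_conjugate mnmE.
Qed.

Lemma initial_minor0 (K : fieldType) (m n : nat) (hmn : (m <= n)%N) :
  initial_minor K hmn ord0 = 1.
Proof. exact: det_mx00. Qed.

Lemma initial_minor_prod_pad (K : fieldType) (m n : nat) (hmn : (m <= n)%N)
    (lam : seq 'I_m.+1) (k : nat) :
  initial_minor_prod K hmn (lam ++ nseq k ord0) = initial_minor_prod K hmn lam.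
Proof.
rewrite /initial_minor_prod big_cat big_nseq /= initial_minor0.
by rewrite iter_mulr_1 expr1n mulr1.
Qed.

Lemma initial_minor_prod_algebra (K : fieldType) (m n t : nat) (hmn : (m <= n)%N)
    (lam : seq 'I_m.+1) :
    [pchar K] =i pred0 -> (\sum_(s <- lam) s = t * size lam)%N ->
  minor_algebra t (initial_minor_prod K hmn lam).
Proof.
move=> K0 sum_lam.
have := @generic_minor_prod_algebra K m n t
  [seq (val s, initial_minor K hmn s) | s <- lam] K0.
rewrite !big_map size_map; apply=> // _ /mapP[s _ ->].
by do 2!eexists.
Qed.

Lemma initial_minor_prod_homog (K : fieldType) (m n : nat) (hmn : (m <= n)%N)
    (lam : seq 'I_m.+1) :
  initial_minor_prod K hmn lam \is (\sum_(s <- lam) s)%N.-homog.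
Proof.
elim: lam => [|s lam IHlam]; rewrite /initial_minor_prod ?big_nil ?big_cons.
  exact: dhomog1.
apply: dhomogM => //; apply: rpred_sum => sigma _; rewrite -scaler_signl.
apply: dhomogZ; rewrite (eq_bigr (fun i => 'X_[U_(mxvec_index
    (widen_ord (leq_ord s) i) (widen_ord (leq_trans (leq_ord s) hmn) (sigma i)))])).
  rewrite -mpolyX_sum dhomogX /= mdeg_sum (eq_bigr (fun=> 1%N)) => [|i _].
    by rewrite sum1_card card_ord.
  by rewrite mdeg1.
by move=> i _; rewrite !mxE.
Qed.

Lemma subalg_gen_mono (K : fieldType) (A : algType K) (S T : A -> Prop) (x : A) :
  (forall y, S y -> T y) -> subalg_gen S x -> subalg_gen T x.
Proof.
move=> sST; elim=> [y /sST|c|y z _ Ty _ Tz|y z _ Ty _ Tz].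
- exact: subalg_gen_in.
- exact: subalg_gen_scalar.
- exact: subalg_gen_add.
exact: subalg_gen_mul.
Qed.

Lemma minor_invariants_subalg (K : fieldType) (m n t : nat)
    (S : {mpoly K[m * n]} -> Prop) (p : {mpoly K[m * n]}) :
    (forall x, S x -> minor_invariants t x) -> subalg_gen S p ->
  minor_invariants t p.
Proof.
move=> SI; elim=> [x /SI //|c|x y _ [Ax Ux] _ [Ay Uy]|x y _ [Ax Ux] _ [Ay Uy]].
- split; first exact: subalg_gen_scalar.
  by move=> A B _ _; rewrite /gl_act comp_mpolyZ comp_mpoly1.
- split; first exact: subalg_gen_add.
  move=> A B uA uB; rewrite /gl_act comp_mpolyD.
  exact: (congr2 _ (Ux A B uA uB) (Uy A B uA uB)).
split; first exact: subalg_gen_mul.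
move=> A B uA uB; rewrite /gl_act rmorphM.
exact: (congr2 _ (Ux A B uA uB) (Uy A B uA uB)).
Qed.

(** These products satisfy both bounds of the theorem at once, on the number of
    parts and on the degree d, so they generate for both claims. *)
Definition small_product (K : fieldType) (m n t : nat) (hmn : (m <= n)%N)
    (p : {mpoly K[m * n]}) : Prop :=
  exists (lam : seq 'I_m.+1) (d : nat),
    [/\ is_partition lam, (\sum_(s <- lam) s = t * d)%N,
        (size lam <= d <= m)%N, (size lam <= m - 1)%N
      & p = initial_minor_prod K hmn lam].

(** Strong induction on the length d of lam, where parts 0 are allowed and stand
    for the factor 1.  If d > m, or if d = m and no part is 0, the deviations
    from t split into two zero-sum families.  Otherwise d <= m and at most
    m - 1 parts are nonzero; these, sorted, are the required partition. *)
Lemma initial_minor_prod_small (K : fieldType) (m n t : nat) (hmn : (m <= n)%N)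
    (lam : seq 'I_m.+1) :
    (1 < t)%N -> (t < m)%N -> (\sum_(s <- lam) s = t * size lam)%N ->
  subalg_gen (@small_product K m n t hmn) (initial_minor_prod K hmn lam).
Proof.
move=> t_gt1 lt_tm.
have [k] := ubnP (size lam); elim: k lam => // k IHk lam /ltnSE le_k sum_lam.
pose dev (s : 'I_m.+1) : int := s%:Z - t%:Z.
have devE (l : seq 'I_m.+1) :
    \sum_(s <- l) dev s = (\sum_(s <- l) s)%N%:Z - (t * size l)%N%:Z.
  elim: l => [|s l IHl]; first by rewrite !big_nil muln0.
  by rewrite !big_cons IHl /dev /= mulnS !PoszD opprD addrACA.
have dev0 : \sum_(s <- lam) dev s = 0 by rewrite devE sum_lam subrr.
have split_step (a b : nat) : (0 < a)%N -> (0 < b)%N ->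
    all (fun s => - a%:Z <= dev s <= b%:Z) lam -> (a + b < size lam)%N ->
    subalg_gen (@small_product K m n t hmn) (initial_minor_prod K hmn lam).
  move=> a0 b0 dev_bd sz.
  have [l1 [l2 [lamE l1n l2n d1 d2]]] := zero_sum_splits a0 b0 dev_bd dev0 sz.
  rewrite /initial_minor_prod (perm_big _ lamE) big_cat /=.
  have := perm_size lamE; rewrite size_cat => szE.
  rewrite -size_eq0 -lt0n in l1n; rewrite -size_eq0 -lt0n in l2n.
  move/eqP: d1; rewrite devE subr_eq0 eqz_nat => /eqP d1.
  move/eqP: d2; rewrite devE subr_eq0 eqz_nat => /eqP d2.
  apply: subalg_gen_mul; apply: IHk => //; apply: leq_trans le_k; rewrite szE.
    by rewrite -[leqLHS]addn1 leq_add2l.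
  by rewrite -[leqLHS]add1n leq_add2r.
have [gt_m|le_m] := ltnP m (size lam).
  (* Deviations range over [- t, m - t]: the window has m values. *)
  apply: (split_step t (m - t)%N); [lia|lia| |lia].
  by apply/allP=> s _; have := ltn_ord s; rewrite /dev; lia.
pose geq_ord := relpre (val : 'I_m.+1 -> nat) geq.
pose mu := sort geq_ord [seq s <- lam | s != ord0].
have mu_perm : perm_eq mu [seq s <- lam | s != ord0] by rewrite perm_sort.
have mu_part : is_partition mu.
  apply/andP; split.
    rewrite sorted_map; apply: sort_sorted => s s'; exact: leq_total.
  rewrite (perm_all _ mu_perm); apply/allP=> s; rewrite mem_filter lt0n.
  by case/andP.
have mu_size : (size mu <= size lam)%N.
  by rewrite (perm_size mu_perm) size_filter count_size.
have mu_sum : (\sum_(s <- mu) s = t * size lam)%N.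
  rewrite -sum_lam (perm_big _ mu_perm) big_filter [RHS](bigID (pred1 ord0)) /=.
  by rewrite [X in (X + _)%N]big1 // => s /eqP->.
have mu_prod : initial_minor_prod K hmn lam = initial_minor_prod K hmn mu.
  rewrite /initial_minor_prod (perm_big _ mu_perm) big_filter.
  rewrite (bigID (pred1 ord0)) /= big1 ?mul1r // => s /eqP->.
  exact: initial_minor0.
have mu_small : (size mu <= m - 1)%N ->
    subalg_gen (@small_product K m n t hmn) (initial_minor_prod K hmn lam).
  move=> mu_lt; apply: subalg_gen_in; exists mu, (size lam).
  by split=> //; rewrite mu_size.
have [lam0|lam_n0] := boolP (ord0 \in lam).
  apply: mu_small; suff: (size mu < size lam)%N by lia.
  rewrite (perm_size mu_perm) size_filter -(count_predC (pred1 ord0) lam).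
  by rewrite -[ltnLHS]add0n ltn_add2r -has_count has_pred1.
have [sz_m|ne_m] := eqVneq (size lam) m; last by apply: mu_small; lia.
(* Without parts 0 deviations start at 1 - t: the window has m - 1 values. *)
apply: (split_step t.-1 (m - t)%N); [lia|lia| |lia].
apply/allP=> s s_lam; have := ltn_ord s.
have: s != ord0 by apply: contraNneq lam_n0 => <-.
by rewrite -val_eqE /dev /=; lia.
Qed.

(** * Generators of the ring of invariants *)

(** An invariant is a combination of products of initial minors, whose shapes
    are admissible; parts 0 are added to make the average part equal to t. *)
Lemma minor_invariants_small (K : fieldType) (m n t : nat) (hmn : (m <= n)%N)
    (p : {mpoly K[m * n]}) :
    [pchar K] =i pred0 -> (1 < t)%N -> (t < m)%N -> minor_invariants t p ->
  subalg_gen (@small_product K m n t hmn) p.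
Proof.
move=> K0 t_gt1 lt_tm [p_alg /(invariant_initial_minors hmn K0)[q p_q]].
rewrite p_q in p_alg *; rewrite comp_mpolyEX big_seq.
apply: big_ind => [|x y|a a_q].
- by rewrite -(scale0r 1); apply: subalg_gen_scalar.
- exact: subalg_gen_add.
apply: subalg_gen_scale; rewrite comp_mpolyX.
have [/dvdnP[d wt] le_t] :=
  initial_minors_in_algebra_support p_alg a_q (leq_ltn_trans (leq0n t) lt_tm).
pose mult (j : 'I_m) := nseq (a j) (lift ord0 j : 'I_m.+1).
pose parts := flatten [seq mult j | j <- enum 'I_m].
have parts_size : size parts = (\sum_(j < m) a j)%N.
  rewrite size_flatten /shape -map_comp sumnE big_map big_enum /=.
  by apply: eq_bigr => j _; rewrite size_nseq.
have parts_sum : (\sum_(s <- parts) s = t * d)%N.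
  rewrite mulnC -wt big_flatten /= big_map big_enum /=.
  by apply: eq_bigr => j _; rewrite big_nseq iter_addn_0.
have parts_prod : \prod_(s <- parts) initial_minor K hmn s =
    \prod_(j < m) tnth [tuple initial_minor K hmn (lift ord0 i) | i < m] j ^+ a j.
  rewrite big_flatten /= big_map big_enum /=; apply: eq_bigr => j _.
  by rewrite big_nseq iter_mulr_1 tnth_mktuple.
have le_d : (size parts <= d)%N.
  by rewrite parts_size -(leq_pmul2l (ltnW t_gt1)) [leqRHS]mulnC -wt.
rewrite -parts_prod -/(initial_minor_prod K hmn parts).
rewrite -(initial_minor_prod_pad K hmn parts (d - size parts)).
apply: initial_minor_prod_small => //.
rewrite size_cat size_nseq subnKC // big_cat big_nseq /= parts_sum.
by rewrite iter_addn_0 mul0n addn0.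
Qed.

Lemma padded_product_invariant (K : fieldType) (m n t d : nat) (hmn : (m <= n)%N)
    (lam : seq 'I_m.+1) :
    [pchar K] =i pred0 -> (\sum_(s <- lam) s = t * d)%N -> (size lam <= d)%N ->
  minor_invariants t (initial_minor_prod K hmn lam).
Proof.
move=> K0 sum_lam le_d; split; last exact: initial_minor_prod_invariant.
rewrite -(initial_minor_prod_pad K hmn lam (d - size lam)).
apply: initial_minor_prod_algebra => //.
rewrite size_cat size_nseq subnKC // big_cat big_nseq /= sum_lam.
by rewrite iter_addn_0 mul0n addn0.
Qed.

Theorem theorem3p3p5 (K : fieldType) (charK0 : [pchar K] =i pred0)
    (t m n : nat) (hmn : (m <= n)%N) (ht1 : (1 < t)%N) (htm : (t < m)%N)
    (htn : (t + 1 < n)%N) :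
  generates
    (fun p : {mpoly K[m * n]} =>
       exists lam : seq 'I_m.+1,
         [/\ is_partition lam, admissible t lam, (size lam <= m - 1)%N
           & p = initial_minor_prod K hmn lam])
    (@minor_invariants K m n t)
  /\
  generates
    (fun p : {mpoly K[m * n]} =>
       minor_invariants t p /\
       exists d : nat, (d <= m)%N /\ minor_algebra_deg t d p)
    (@minor_invariants K m n t).
Proof.
have t_gt0 := ltnW ht1; split=> p; split.
- move/(minor_invariants_small hmn charK0 ht1 htm); apply: subalg_gen_mono.
  move=> _ [lam [d [lam_part lam_sum /andP[le_d _] le_m ->]]].
  exists lam; split=> //.
  by rewrite /admissible lam_sum dvdn_mulr // leq_mul2l le_d orbT.
- apply: minor_invariants_subalg => _ [lam [_ /andP[/dvdnP[d wt] le_wt] _ ->]].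
  rewrite mulnC in wt; apply: (padded_product_invariant _ charK0 wt).
  by rewrite -(leq_pmul2l t_gt0) -wt.
- move/(minor_invariants_small hmn charK0 ht1 htm); apply: subalg_gen_mono.
  move=> _ [lam [d [_ lam_sum /andP[le_d d_m] _ ->]]].
  have inv := padded_product_invariant hmn charK0 lam_sum le_d.
  split=> //; exists d; split=> //; split; first by case: inv.
  by rewrite -lam_sum; apply: initial_minor_prod_homog.
by apply: minor_invariants_subalg => x [].
Qed.
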